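(* Let $E=(E^0,E^1,r,s)$ be a directed graph and let $\mathbb{F}$ be the free group generated by $E^1$. Then the partial group C*-algebra with projections and relations $C^*(\mathbb{F},R_E)$ is $*$-isomorphic to the unitization $\widetilde{C^*(E)}$ of the graph C*-algebra $C^*(E)$.
   Context: $E^0$ is the set of vertices, $E^1$ the set of edges, and $r,s:E^1\to E^0$ are the range and source maps. The graph C*-algebra $C^*(E)$ is the universal C*-algebra generated by mutually orthogonal projections $\{Q_v\}_{v\in E^0}$ and partial isometries $\{S_a\}_{a\in E^1}$ with the relations: $S_a^*S_b=0$ for $a,b\in E^1$, $a\neq b$; $S_a^*S_a=Q_{s(a)}$ for $a\in E^1$; $S_aS_a^*\leq Q_{r(a)}$ for $a\in E^1$; $Q_v=\sum_{b\in r^{-1}(v)}S_bS_b^*$ if $0<\#r^{-1}(v)<\infty$. $\widetilde{C^*(E)}$ is the C*-algebra obtained from $C^*(E)$ by adjoining a new unit (as a vector space $C^*(E)\oplus\mathbb{C}1$; a new unit is adjoined even when $C^*(E)$ is already unital). Let $e$ be the neutral element of $\mathbb{F}$ and $|g|$ the length of the reduced form of $g\in\mathbb{F}$. The algebra $C^*(\mathbb{F},R_E)$ is the universal C*-algebra generated by $\{[g]:g\in\mathbb{F}\}$ and $\{P_i\}_{i\in E^0\cup\{0\}}$, where $0\notin E^0$ and $P_0=1$, subject to the following relations. First, the relations of a partial group algebra with projections, for all $g,h\in\mathbb{F}$ and $u,v\in E^0$: $[e]=1$; $[g^{-1}]=[g]^*$; $[g][h][h^{-1}]=[gh][h^{-1}]$;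 $P_u^*=P_u=P_u^2$; $[g][g]^*$ and $[h]P_v[h]^*$ commute; $[g]P_u[g]^*$ and $[h]P_v[h]^*$ commute. Second, the relations given by the set $R_E$: (1) $P_uP_v=0$ for $u,v\in E^0$, $u\neq v$; (2) $[a^{-1}][a^{-1}]^*-P_{s(a)}=0$, i.e. $[a]^*[a]=P_{s(a)}$, for $a\in E^1$; (3) $[a][a]^*[b][b]^*=0$ for $a,b\in E^1$, $a\neq b$; (4) $P_v-\sum_{a\in r^{-1}(v)}[a][a]^*=0$ for $v\in E^0$ with $0<\#r^{-1}(v)<\infty$; (5) $[gh][gh]^*[g][g]^*-[gh][gh]^*=0$ for $g,h\in\mathbb{F}$ with $|gh|=|g|+|h|$; (6) $[a][a]^*P_{r(a)}-[a][a]^*=0$ for $a\in E^1$. *)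

(* Defs.v *)
From HB Require Import structures.
From mathcomp Require Import all_boot all_order all_algebra.
From mathcomp Require Import complex.
From mathcomp Require Import all_classical all_reals all_analysis.

Set Implicit Arguments.
Unset Strict Implicit.
Unset Printing Implicit Defensive.

Import Order.TTheory GRing.Theory Num.Theory numFieldNormedType.Exports.

Local Open Scope classical_set_scope.
Local Open Scope ring_scope.

(* The multiplication is not assumed to have a unit, hence is not the one of
   the ring structures of the library. *)
HB.mixin Record CompleteNormedModule_isCStarAlgebra (R : realType) A
    of CompleteNormedModule R[i] A := {
  cmul : A -> A -> A;
  star : A -> A;
  cmulA : associative cmul;
  cmulDl : left_distributive cmul +%R;
  cmulDr : right_distributive cmul +%R;
  cmulZl : forall (k : R[i]) (x y : A), cmul (k *: x) y = k *: cmul x y;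
  cmulZr : forall (k : R[i]) (x y : A), cmul x (k *: y) = k *: cmul x y;
  starK : involutive star;
  starD : {morph star : x y / x + y};
  starZ : forall (k : R[i]) (x : A), star (k *: x) = k^* *: star x;
  starM : forall x y : A, star (cmul x y) = cmul (star y) (star x);
  norm_cmul : forall x y : A, `|cmul x y| <= `|x| * `|y|;
  norm_star_cmul : forall x : A, `|cmul (star x) x| = `|x| ^+ 2
}.

#[short(type="cstarAlgType")]
HB.structure Definition CStarAlgebra (R : realType) :=
  {A of CompleteNormedModule R[i] A & CompleteNormedModule_isCStarAlgebra R A}.

Infix "**" := cmul (at level 40, left associativity) : ring_scope.

Section cstar_notions.
Variable R : realType.

Definition is_unit (A : cstarAlgType R) (u : A) : Prop :=
  forall x : A, u ** x = x /\ x ** u = x.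

Definition is_projection (A : cstarAlgType R) (p : A) : Prop :=
  star p = p /\ p ** p = p.

Definition is_partial_isometry (A : cstarAlgType R) (x : A) : Prop :=
  x ** star x ** x = x.

(* The order on projections: [p] is a subprojection of [q]. *)
Definition proj_le (A : cstarAlgType R) (p q : A) : Prop :=
  p ** q = p.

Definition commuting (A : cstarAlgType R) (x y : A) : Prop :=
  x ** y = y ** x.

Record is_star_hom (A B : cstarAlgType R) (phi : A -> B) : Prop := IsStarHom {
  star_hom_linear : linear phi;
  star_hom_mul : {morph phi : x y / x ** y};
  star_hom_star : {morph phi : x / star x}
}.

Definition star_isomorphic (A B : cstarAlgType R) : Prop :=
  exists2 phi : A -> B, is_star_hom phi & bijective phi.

(* [A], with the family [f], is the universal C*-algebra generated by a family
   indexed by [G] and subject to the relations [rel]. Uniqueness of the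
   homomorphism expresses that the family [f] generates [A]. *)
Definition is_universal (G : Type)
    (rel : forall D : cstarAlgType R, (G -> D) -> Prop)
    (A : cstarAlgType R) (f : G -> A) : Prop :=
  rel A f /\
  forall (D : cstarAlgType R) (h : G -> D), rel D h ->
    exists! phi : A -> D, is_star_hom phi /\ forall x : G, phi (f x) = h x.

End cstar_notions.

Section nreal.
Variable R : realType.

(* The norms of the library take their values in the scalars [R[i]]. *)
Definition nreal (V : normedModType R[i]) (x : V) : R := complex.Re `|x|.

Lemma nrealE (V : normedModType R[i]) (x : V) : `|x| = (nreal x)%:C%C.
Proof. by rewrite /nreal RRe_real// ger0_real. Qed.

Lemma nreal_ge0 (V : normedModType R[i]) (x : V) : 0 <= nreal x.
Proof. by rewrite -ler0c -nrealE. Qed.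

Lemma nrealD (V : normedModType R[i]) (x y : V) :
  nreal (x + y) <= nreal x + nreal y.
Proof. by rewrite -lecR rmorphD/= -!nrealE ler_normD. Qed.

Lemma nrealZ (V : normedModType R[i]) (k : R[i]) (x : V) :
  nreal (k *: x) = nreal (k : R[i]^o) * nreal x.
Proof. by apply: complexI; rewrite rmorphM/= -!nrealE normrZ. Qed.

Lemma nreal_eq0 (V : normedModType R[i]) (x : V) : nreal x = 0 -> x = 0.
Proof. by move=> x0; apply/normr0_eq0; rewrite nrealE x0. Qed.

Lemma nreal0 (V : normedModType R[i]) : nreal (0 : V) = 0.
Proof. by rewrite /nreal normr0. Qed.

Lemma nrealN (V : normedModType R[i]) (x : V) : nreal (- x) = nreal x.
Proof. by rewrite /nreal normrN. Qed.

Lemma nreal_ball (V : normedModType R[i]) (x y : V) (e : R) :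
  ball x e%:C%C y <-> nreal (x - y) < e.
Proof. by rewrite -ball_normE /ball_/= nrealE ltcR. Qed.

Lemma complex_gt0 (e : R[i]) : 0 < e -> e = (complex.Re e)%:C%C.
Proof. by move=> e0; rewrite RRe_real// gtr0_real. Qed.

Lemma nreal_Re_Im (z : R[i]) :
  [/\ `|complex.Re z| <= nreal (z : R[i]^o), `|complex.Im z| <= nreal (z : R[i]^o)
    & nreal (z : R[i]^o) <= `|complex.Re z| + `|complex.Im z|].
Proof.
rewrite /nreal normc_def /=; split.
- by rewrite -sqrtr_sqr ler_sqrt ?lerDl ?addr_ge0 ?sqr_ge0.
- by rewrite -sqrtr_sqr ler_sqrt ?lerDr ?addr_ge0 ?sqr_ge0.
rewrite -[leRHS]ger0_norm ?addr_ge0// -sqrtr_sqr ler_sqrt ?sqr_ge0//.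
by rewrite sqrrD !real_normK ?num_real// lerD2r lerDl mulrn_wge0// mulr_ge0.
Qed.

Lemma complex_complete (F : set_system R[i]^o) :
  ProperFilter F -> cauchy F -> cvg F.
Proof.
move=> FF /cauchyP Fc.
have cvg_part (f : R[i]^o -> R) : (forall y z, f (y - z) = f y - f z) ->
    (forall z, `|f z| <= nreal z) -> cvg (f @ F).
  move=> fB fle; apply: R_complete; apply/cauchyP => e e0.
  have [z Fz] := Fc e%:C%C ltac:(by rewrite ltcR).
  exists (f z); change (F (f @^-1` ball (f z) e)).
  apply: filterS Fz => y /nreal_ball zy.
  rewrite /= -ball_normE /ball_/=; apply: le_lt_trans zy.
  by apply: le_trans (fle _); rewrite fB.
have /cvg_ex[/= a Fa] : cvg ((@complex.Re R : R[i]^o -> R) @ F).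
  by apply: cvg_part => [[? ?] [? ?]//|z]; case: (nreal_Re_Im z).
have /cvg_ex[/= b Fb] : cvg ((@complex.Im R : R[i]^o -> R) @ F).
  by apply: cvg_part => [[? ?] [? ?]//|z]; case: (nreal_Re_Im z).
apply/cvg_ex; exists (a +i* b)%C; apply/cvgrPdist_lt => e /[dup] e0.
move=> /complex_gt0 eE; move: e0; rewrite eE; set r := complex.Re e.
rewrite ltcR => r0.
have r20 : 0 < r / 2 by rewrite divr_gt0.
move/cvgrPdist_lt : Fa => /(_ _ r20) Fa; move/cvgrPdist_lt : Fb => /(_ _ r20) Fb.
near=> z; rewrite nrealE ltcR.
have [_ _ /le_lt_trans] := nreal_Re_Im ((a +i* b)%C - z); apply.
rewrite [r]splitr ltrD//.
  rewrite (_ : complex.Re _ = a - complex.Re z); last by case: (z).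
  by near: z; exact: Fa.
rewrite (_ : complex.Im _ = b - complex.Im z); last by case: (z).
by near: z; exact: Fb.
Unshelve. all: by end_near. Qed.

End nreal.

Section unitization.
Variables (R : realType) (B : cstarAlgType R).

Definition unitization : Type := (B * R[i]^o)%type.

HB.instance Definition _ :=
  GRing.Lmodule.copy unitization (B * R[i]^o)%type.

Implicit Types (x y z : unitization) (b : B).

Definition unit_mul x y : unitization :=
  (x.1 ** y.1 + x.2 *: y.1 + y.2 *: x.1, x.2 * y.2).

Definition unit_star x : unitization := (star x.1, x.2^*).

(* Left multiplication on the ideal [B]. *)
Definition unit_act x b : B := x.1 ** b + x.2 *: b.

Definition unit_opnorm x : R :=
  sup [set nreal (unit_act x b) | b in [set b | nreal b <= 1]].

(* The maximum with the modulus of the scalar part is needed when [B] is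
   already unital, as the action on [B] is then not faithful. *)
Definition unit_norm x : R[i] :=
  (Num.max (nreal x.2) (unit_opnorm x))%:C%C.

Lemma nreal_cmul (a b : B) : nreal (a ** b) <= nreal a * nreal b.
Proof. by rewrite -lecR rmorphM/= -!nrealE norm_cmul. Qed.

Lemma nreal_star_cmul (a : B) : nreal (star a ** a) = nreal a ^+ 2.
Proof. by apply: complexI; rewrite rmorphXn/= -!nrealE norm_star_cmul. Qed.

Lemma nreal_star (a : B) : nreal (star a) = nreal a.
Proof.
have le_star (c : B) : nreal c <= nreal (star c).
  have [->|c0] := eqVneq (nreal c) 0; first exact: nreal_ge0.
  have cgt0 : 0 < nreal c by rewrite lt_neqAle eq_sym c0 nreal_ge0.
  by rewrite -(ler_pM2r cgt0) -expr2 -nreal_star_cmul nreal_cmul.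
by apply: le_anti; rewrite le_star andbT -{2}(starK a) le_star.
Qed.

Lemma cmul0 (a : B) : a ** 0 = 0.
Proof. by apply: (addIr (a ** 0)); rewrite -cmulDr !add0r. Qed.

Lemma cmul0x (a : B) : 0 ** a = 0.
Proof. by apply: (addIr (0 ** a)); rewrite -cmulDl !add0r. Qed.

Lemma unit_opnorm_has_sup x :
  has_sup [set nreal (unit_act x b) | b in [set b | nreal b <= 1]].
Proof.
split; first by exists (nreal (unit_act x 0)), 0; rewrite //= nreal0 ler01.
exists (nreal x.1 + nreal x.2) => _ [b /= b1 <-].
rewrite (le_trans (nrealD _ _))// lerD// ?nrealZ.
  by rewrite (le_trans (nreal_cmul _ _))// ler_piMr// nreal_ge0.
by rewrite ler_piMr// nreal_ge0.
Qed.

Lemma unit_actZ x (k : R[i]) b : unit_act x (k *: b) = k *: unit_act x b.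
Proof. by rewrite /unit_act cmulZr scalerDr !scalerA [k * _]mulrC. Qed.

Lemma unit_act_le x b : nreal (unit_act x b) <= unit_opnorm x * nreal b.
Proof.
have [b0|b0] := eqVneq (nreal b) 0.
  have -> : b = 0 by exact: nreal_eq0.
  by rewrite /unit_act cmul0 scaler0 addr0 nreal0 mulr0.
have bgt0 : 0 < nreal b by rewrite lt_neqAle eq_sym b0 nreal_ge0.
have nk : nreal (((nreal b)^-1)%:C%C : R[i]^o) = (nreal b)^-1.
  by rewrite /nreal normc_def /= expr0n addr0 sqrtr_sqr ger0_norm// invr_ge0 nreal_ge0.
rewrite -ler_pdivrMr// mulrC -{1}nk -nrealZ -unit_actZ.
apply: ub_le_sup; first by case: (unit_opnorm_has_sup x).
by exists ((nreal b)^-1%:C%C *: b) => //=; rewrite nrealZ nk mulVf.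
Qed.

Lemma unit_opnorm_le x (c : R) : 0 <= c ->
  (forall b, nreal (unit_act x b) <= c * nreal b) -> unit_opnorm x <= c.
Proof.
move=> c0 H; apply: ge_sup; first by case: (unit_opnorm_has_sup x).
by move=> _ [b /= b1 <-]; rewrite (le_trans (H b))// ler_piMr.
Qed.

Lemma unit_opnorm_ge0 x : 0 <= unit_opnorm x.
Proof.
apply: ub_le_sup; first by case: (unit_opnorm_has_sup x).
exists 0; first by rewrite /= nreal0 ler01.
by rewrite /unit_act cmul0 scaler0 addr0 nreal0.
Qed.

Local Notation un x := (Num.max (nreal x.2) (unit_opnorm x)).

Lemma un_ge0 x : 0 <= un x.
Proof. by rewrite le_max nreal_ge0. Qed.

Lemma un_le x (c : R) : nreal x.2 <= c ->
  (forall b, nreal (unit_act x b) <= c * nreal b) -> un x <= c.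
Proof.
move=> xc H; rewrite ge_max xc unit_opnorm_le//.
exact: le_trans (nreal_ge0 _) xc.
Qed.

Lemma un_ge2 x : nreal x.2 <= un x.
Proof. by rewrite le_max lexx. Qed.

Lemma un_geop x : unit_opnorm x <= un x.
Proof. by rewrite le_max lexx orbT. Qed.

Lemma un_act x b : nreal (unit_act x b) <= un x * nreal b.
Proof.
by rewrite (le_trans (unit_act_le _ _))// ler_wpM2r ?nreal_ge0// un_geop.
Qed.

Lemma unit_normD x y : unit_norm (x + y) <= unit_norm x + unit_norm y.
Proof.
rewrite /unit_norm -rmorphD lecR; apply: un_le => [|b].
  by rewrite (le_trans (nrealD _ _))// lerD// un_ge2.
have -> : unit_act (x + y) b = unit_act x b + unit_act y b.
  by rewrite /unit_act /= cmulDl scalerDl addrACA.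
by rewrite mulrDl (le_trans (nrealD _ _))// lerD// un_act.
Qed.

Lemma nreal_scalar (k l : R[i]) :
  nreal (k * l : R[i]^o) = nreal (k : R[i]^o) * nreal (l : R[i]^o).
Proof. exact: (@nrealZ R R[i]^o k l). Qed.

Lemma unit_normZ (k : R[i]) x : unit_norm (k *: x) = `|k| * unit_norm x.
Proof.
have nkE (l : R[i]) : `|l| = (nreal (l : R[i]^o))%:C%C.
  exact: (@nrealE R R[i]^o l).
have le_un (l : R[i]) y : un (l *: y) <= nreal (l : R[i]^o) * un y.
  apply: un_le => [|b].
    by rewrite nreal_scalar ler_wpM2l ?nreal_ge0// un_ge2.
  have -> : unit_act (l *: y) b = l *: unit_act y b.
    by rewrite /unit_act /= cmulZl scalerDr scalerA.
  by rewrite nrealZ -mulrA ler_wpM2l ?nreal_ge0// un_act.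
rewrite nkE /unit_norm -rmorphM; congr (_%:C)%C.
apply: le_anti; rewrite le_un/=.
have [->|k0] := eqVneq k 0.
  by rewrite nreal0 mul0r le_max nreal_ge0.
have nk0 : nreal (k : R[i]^o) != 0.
  by apply: contra_neq k0 => /nreal_eq0.
have nkgt0 : 0 < nreal (k : R[i]^o).
  by rewrite lt_neqAle eq_sym nk0 nreal_ge0.
have := le_un k^-1 (k *: x).
rewrite scalerA mulVf// scale1r.
have -> : nreal (k^-1 : R[i]^o) = (nreal (k : R[i]^o))^-1.
  apply: (mulfI nk0); rewrite -nreal_scalar !divff//.
  by rewrite /nreal normr1.
by rewrite ler_pdivlMl.
Qed.

Lemma unit_norm_fst x : nreal x.1 <= un x + un x.
Proof.
have [->|a0] := eqVneq (nreal x.1) 0; first by rewrite addr_ge0 ?un_ge0.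
have agt0 : 0 < nreal x.1 by rewrite lt_neqAle eq_sym a0 nreal_ge0.
rewrite -(ler_pM2r agt0) -expr2 -[in leLHS]nreal_star -nreal_star_cmul starK.
have -> : x.1 ** star x.1 = unit_act x (star x.1) - x.2 *: star x.1.
  by rewrite /unit_act addrK.
rewrite (le_trans (nrealD _ _))// nrealN nrealZ mulrDl.
rewrite -[nreal x.1]nreal_star lerD ?un_act//.
by rewrite ler_wpM2r ?nreal_ge0// un_ge2.
Qed.

Lemma unit_norm_le_prod x : un x <= nreal x.1 + nreal x.2.
Proof.
apply: un_le => [|b]; first by rewrite lerDr nreal_ge0.
by rewrite mulrDl (le_trans (nrealD _ _))// lerD ?nreal_cmul// nrealZ.
Qed.

Lemma unit_norm0_eq0 x : unit_norm x = 0 -> x = 0.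
Proof.
move=> /complexI n0.
have x2 : x.2 = 0.
  apply: nreal_eq0; apply: le_anti; rewrite nreal_ge0 andbT -n0; exact: un_ge2.
have x1 : x.1 = 0.
  apply: nreal_eq0; apply: le_anti; rewrite nreal_ge0 andbT.
  by rewrite (le_trans (unit_norm_fst x))// n0 addr0.
by case: x x1 x2 {n0} => ? ? /= -> ->.
Qed.

HB.instance Definition _ :=
  Lmodule_isNormed.Build R[i] unitization unit_normD unit_normZ unit_norm0_eq0.


Lemma nreal_unitE x : nreal x = un x.
Proof. by []. Qed.

Lemma unit_complete (F : set_system unitization) :
  ProperFilter F -> cauchy F -> cvg F.
Proof.
move=> FF /cauchyP Fc.
have /cvg_ex[/= a Fa] : cvg ((fst : unitization -> B) @ F).
  apply: cauchy_cvg; apply/cauchyP => e /[dup] e0 /complex_gt0 eE.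
  move: e0; rewrite eE; set r := complex.Re e; rewrite ltcR => r0.
  have [z Fz] := Fc (r / 2)%:C%C ltac:(by rewrite ltcR divr_gt0).
  exists z.1; change (F ((fst : unitization -> B) @^-1` ball z.1 r%:C%C)).
  apply: filterS Fz => y /nreal_ball zy; apply/nreal_ball.
  rewrite [r]splitr; apply: le_lt_trans (unit_norm_fst (z - y)) _.
  by rewrite ltrD.
have /cvg_ex[/= b Fb] : cvg ((snd : unitization -> R[i]^o) @ F).
  apply: complex_complete; apply/cauchyP => e /[dup] e0 /complex_gt0 eE.
  move: e0; rewrite eE; set r := complex.Re e; rewrite ltcR => r0.
  have [z Fz] := Fc r%:C%C ltac:(by rewrite ltcR).
  exists z.2; change (F ((snd : unitization -> R[i]^o) @^-1` ball z.2 r%:C%C)).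
  apply: filterS Fz => y /nreal_ball zy; apply/nreal_ball.
  by apply: le_lt_trans (un_ge2 (z - y)) _.
apply/cvg_ex; exists ((a, b) : unitization); apply/cvgrPdist_lt => e /[dup] e0.
move=> /complex_gt0 eE; move: e0; rewrite eE; set r := complex.Re e.
rewrite ltcR => r0.
have r20 : 0 < (r / 2)%:C%C :> R[i] by rewrite ltcR divr_gt0.
move/cvgrPdist_lt : Fa => /(_ _ r20) Fa; move/cvgrPdist_lt : Fb => /(_ _ r20) Fb.
near=> z; rewrite nrealE ltcR.
apply: le_lt_trans (unit_norm_le_prod (((a, b) : unitization) - z)) _.
rewrite [r]splitr ltrD//.
  by rewrite -ltcR -nrealE; near: z; exact: Fa.
by rewrite -ltcR -nrealE; near: z; exact: Fb.
Unshelve. all: by end_near. Qed.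

HB.instance Definition _ := Uniform_isComplete.Build unitization unit_complete.

Lemma unit_mulA : associative unit_mul.
Proof.
move=> x y z; rewrite /unit_mul /= mulrA; congr pair.
rewrite !(cmulDl, cmulDr, scalerDr, cmulZl, cmulZr, cmulA, scalerA).
rewrite [z.2 * x.2]mulrC [z.2 * y.2]mulrC -!addrA; congr (_ + _).
rewrite [RHS]addrCA; congr (_ + _).
by rewrite addrCA; congr (_ + _); rewrite addrCA.
Qed.

Lemma unit_mulDl : left_distributive unit_mul +%R.
Proof.
move=> x y z; congr pair => /=; last by rewrite mulrDl.
rewrite cmulDl scalerDl scalerDr [RHS]addrACA; congr (_ + _).
by rewrite addrACA.
Qed.

Lemma unit_mulDr : right_distributive unit_mul +%R.
Proof.
move=> x y z; congr pair => /=; last by rewrite mulrDr.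
rewrite cmulDr scalerDl scalerDr [RHS]addrACA; congr (_ + _).
by rewrite addrACA.
Qed.

Lemma unit_mulZl (k : R[i]) x y : unit_mul (k *: x) y = k *: unit_mul x y.
Proof.
congr pair => /=; last by rewrite /GRing.scale/= mulrA.
by rewrite cmulZl !scalerDr !scalerA [y.2 * k]mulrC.
Qed.

Lemma unit_mulZr (k : R[i]) x y : unit_mul x (k *: y) = k *: unit_mul x y.
Proof.
congr pair => /=; last by rewrite /GRing.scale/= mulrCA.
by rewrite cmulZr !scalerDr !scalerA [x.2 * k]mulrC.
Qed.

Lemma unit_starK : involutive unit_star.
Proof. by move=> [a k]; rewrite /unit_star /= starK conjCK. Qed.

Lemma unit_starD : {morph unit_star : x y / x + y}.
Proof. by move=> x y; congr pair => /=; rewrite ?starD// rmorphD. Qed.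

Lemma unit_starZ (k : R[i]) x : unit_star (k *: x) = k^* *: unit_star x.
Proof. by congr pair => /=; rewrite ?starZ// rmorphM. Qed.

Lemma unit_starM x y : unit_star (unit_mul x y) = unit_mul (unit_star y) (unit_star x).
Proof.
congr pair => /=; last by rewrite rmorphM mulrC.
by rewrite !starD !starZ starM addrAC.
Qed.

Lemma unit_act_mul x y b : unit_act (unit_mul x y) b = unit_act x (unit_act y b).
Proof.
rewrite /unit_act /= !cmulDl !cmulDr !cmulZl cmulZr scalerDr scalerA cmulA.
by rewrite -!addrA; congr (_ + _); rewrite addrCA.
Qed.

Lemma un_mul x y : un (unit_mul x y) <= un x * un y.
Proof.
apply: un_le => [|b].
  by rewrite nreal_scalar ler_pM ?nreal_ge0// un_ge2.
rewrite unit_act_mul (le_trans (un_act _ _))// -mulrA ler_wpM2l ?un_ge0//.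
exact: un_act.
Qed.

Lemma un_star_mul_ge x : un x ^+ 2 <= un (unit_mul (unit_star x) x).
Proof.
set y := unit_mul _ _.
rewrite -[leRHS]sqr_sqrtr ?un_ge0// lerXn2r ?nnegrE ?un_ge0 ?sqrtr_ge0//.
have le_sqrt (r s : R) : 0 <= r -> r ^+ 2 <= s -> r <= Num.sqrt s.
  by move=> r0 rs; rewrite -[r]ger0_norm// -sqrtr_sqr ler_sqrt// (le_trans _ rs)// sqr_ge0.
apply: un_le => [|b].
  apply: le_sqrt; first exact: nreal_ge0.
  apply: le_trans (un_ge2 y); rewrite /y /= nreal_scalar expr2.
  rewrite [in leRHS]/nreal norm_conjC; exact: lexx.
rewrite -[nreal b]ger0_norm ?nreal_ge0// -sqrtr_sqr -sqrtrM ?un_ge0//.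
apply: le_sqrt; first exact: nreal_ge0.
rewrite -nreal_star_cmul.
have -> : star (unit_act x b) ** unit_act x b = star b ** unit_act y b.
  rewrite unit_act_mul [unit_act (unit_star x) _]/unit_act /=.
  have : star (unit_act x b) = star b ** star x.1 + x.2^* *: star b.
    by rewrite /unit_act starD starM starZ.
  move: (unit_act x b) => w ->.
  by rewrite cmulDl cmulZl cmulDr cmulZr cmulA.
rewrite (le_trans (nreal_cmul _ _))// nreal_star expr2 mulrCA ler_wpM2l ?nreal_ge0//.
exact: un_act.
Qed.

Lemma un_star x : un (unit_star x) = un x.
Proof.
have le_star z : un z <= un (unit_star z).
  have [->|z0] := eqVneq (un z) 0; first exact: un_ge0.
  have zgt0 : 0 < un z by rewrite lt_neqAle eq_sym z0 un_ge0.
  rewrite -(ler_pM2r zgt0) -expr2.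
  by apply: le_trans (un_star_mul_ge z) _; exact: un_mul.
have := le_star (unit_star x); rewrite unit_starK => xs.
by apply: le_anti; apply/andP; split; [exact: xs | exact: le_star].
Qed.

Lemma unit_norm_mul x y : `|unit_mul x y| <= `|x| * `|y|.
Proof. by rewrite !nrealE -rmorphM lecR; exact: un_mul. Qed.

Lemma unit_norm_star_mul x : `|unit_mul (unit_star x) x| = `|x| ^+ 2.
Proof.
rewrite !nrealE -rmorphXn; congr (_%:C)%C.
apply: le_anti; apply/andP; split; last exact: un_star_mul_ge.
by rewrite expr2; apply: le_trans (un_mul _ _) _; rewrite un_star.
Qed.

HB.instance Definition _ := CompleteNormedModule_isCStarAlgebra.Build R
  unitization unit_mulA unit_mulDl unit_mulDr unit_mulZl unit_mulZr unit_starK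
  unit_starD unit_starZ unit_starM unit_norm_mul unit_norm_star_mul.

Lemma unitization_unit : is_unit ((0, 1) : unitization).
Proof.
move=> [b k]; split; congr pair; rewrite /= ?mul1r ?mulr1//.
  by rewrite cmul0x scale1r scaler0 add0r addr0.
by rewrite cmul0 scale1r scaler0 !add0r.
Qed.

End unitization.

Section free_group.
Variable X : choiceType.

(* The letter [(x, true)] stands for the generator [x] and [(x, false)] for its
   inverse. *)
Definition letter : Type := (X * bool)%type.

HB.instance Definition _ := Choice.on letter.

Definition letter_inv (l : letter) : letter := (l.1, ~~ l.2).

Definition reduced (w : seq letter) : bool :=
  sorted (fun l m => m != letter_inv l) w.

Record free_group : Type := FreeGroup {
  word :> seq letter;
  word_reduced : reduced word
}.

HB.instance Definition _ := [isSub for word].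
HB.instance Definition _ := [Choice of free_group by <:].

Definition push (l : letter) (w : seq letter) : seq letter :=
  if w is m :: w' then if m == letter_inv l then w' else l :: w else [:: l].

Lemma letter_invK : involutive letter_inv.
Proof. by case=> x b; rewrite /letter_inv /= negbK. Qed.

Lemma push_reduced l w : reduced w -> reduced (push l w).
Proof.
case: w => [//|m w] /=; case: eqVneq => [_|ml] mw /=; last by rewrite ml.
by case: w mw => [//|n w] /= /andP[].
Qed.

Lemma pushK l w : reduced w -> push (letter_inv l) (push l w) = w.
Proof.
case: w => [_|m w] /=; first by rewrite letter_invK eqxx.
case: eqVneq => [->|ml] mw /=; last by rewrite letter_invK eqxx.
case: w mw => [//|n w] /= /andP[].
by rewrite letter_invK => /negPf ->.
Qed.

Definition reduce_onto (w u : seq letter) : seq letter := foldr push w u.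

Lemma reduce_onto_reduced w u : reduced w -> reduced (reduce_onto w u).
Proof. by move=> rw; elim: u => //= l u IH; exact: push_reduced. Qed.

Lemma reduce_onto_push w l u : reduced w ->
  reduce_onto w (push l u) = push l (reduce_onto w u).
Proof.
case: u => [//|m u] rw /=; case: eqVneq => [->|//].
by have := pushK (letter_inv l) (reduce_onto_reduced u rw); rewrite letter_invK.
Qed.

Lemma reduce_ontoA w u v : reduced w ->
  reduce_onto w (reduce_onto v u) = reduce_onto (reduce_onto w v) u.
Proof. by move=> rw; elim: u => //= l u IH; rewrite reduce_onto_push// IH. Qed.

Lemma reduce_onto_nil u : reduced u -> reduce_onto [::] u = u.
Proof.
elim: u => //= l u IH lu; rewrite IH; last exact: path_sorted lu.
by case: u lu {IH} => [//|m u] /= /andP[/negPf -> _].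
Qed.

Definition word_inv (w : seq letter) : seq letter := rev (map letter_inv w).

Lemma word_inv_reduced w : reduced w -> reduced (word_inv w).
Proof.
rewrite /reduced /word_inv rev_sorted sorted_map.
by apply: sub_sorted => l m; rewrite /= letter_invK eq_sym.
Qed.

Lemma word_inv_mul w v : reduced v ->
  reduce_onto (reduce_onto v w) (word_inv w) = v.
Proof.
rewrite /word_inv => rv; elim: w => //= l w IH.
rewrite rev_cons /reduce_onto foldr_rcons -/(reduce_onto _ _) pushK ?IH//.
exact: reduce_onto_reduced.
Qed.

Lemma word_invK : involutive word_inv.
Proof. by move=> w; rewrite /word_inv map_rev revK (mapK letter_invK). Qed.

Definition free_one : free_group := @FreeGroup [::] isT.
Definition free_inv (g : free_group) : free_group :=
  FreeGroup (word_inv_reduced (word_reduced g)).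
Definition free_mul (g h : free_group) : free_group :=
  FreeGroup (reduce_onto_reduced g (word_reduced h)).

Lemma free_mulA : associative free_mul.
Proof.
by move=> g h k; apply: val_inj; rewrite /= reduce_ontoA// word_reduced.
Qed.

Lemma free_mul1g : left_id free_one free_mul.
Proof. by move=> g; exact: val_inj. Qed.

Lemma free_mulg1 : right_id free_one free_mul.
Proof. by move=> g; apply: val_inj; rewrite /= reduce_onto_nil// word_reduced. Qed.

Lemma free_mulVg : left_inverse free_one free_inv free_mul.
Proof.
move=> g; apply: val_inj => /=.
by have := @word_inv_mul g [::] isT; rewrite reduce_onto_nil// word_reduced.
Qed.

Lemma free_mulgV : right_inverse free_one free_inv free_mul.
Proof.
move=> g; apply: val_inj => /=.
have := @word_inv_mul (word_inv g) [::] isT.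
by rewrite word_invK reduce_onto_nil// word_inv_reduced// word_reduced.
Qed.

HB.instance Definition _ := isGroup.Build free_group
  free_mulA free_mul1g free_mulg1 free_mulVg free_mulgV.

Definition free_gen (x : X) : free_group := @FreeGroup [:: (x, true)] isT.

Definition free_length (g : free_group) : nat := size (word g).

End free_group.

Section relations.
Variables (R : realType) (E0 E1 : choiceType) (r s : E1 -> E0).

(* Relations of the graph C*-algebra of the directed graph with vertices [E0],
   edges [E1], range map [r] and source map [s]. *)
Record graph_relations (D : cstarAlgType R) (Q : E0 -> D) (S : E1 -> D) : Prop :=
  GraphRelations {
  graph_proj : forall v, is_projection (Q v);
  graph_orth : forall u v, u <> v -> Q u ** Q v = 0;
  graph_pisom : forall a, is_partial_isometry (S a);
  graph_range_orth : forall a b, a <> b -> star (S a) ** S b = 0;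
  graph_source : forall a, star (S a) ** S a = Q (s a);
  graph_range_le : forall a, proj_le (S a ** star (S a)) (Q (r a));
  graph_sum : forall v, r @^-1` [set v] !=set0 -> finite_set (r @^-1` [set v]) ->
    Q v = \sum_(b \in r @^-1` [set v]) S b ** star (S b)
}.

Definition is_graph_cstar (A : cstarAlgType R) (f : E0 + E1 -> A) : Prop :=
  is_universal
    (fun D (h : E0 + E1 -> D) => graph_relations (h \o inl) (h \o inr)) f.

(* The index [None] is the index 0 of the projection P_0 = 1; the field
   [pga_unit] makes the algebra unital. *)
Record partial_group_relations (D : cstarAlgType R)
    (T : free_group E1 -> D) (P : option E0 -> D) : Prop :=
  PartialGroupRelations {
  pga_unit : is_unit (P None);
  pga_one : T 1%g = P None;
  pga_inv : forall g, T g^-1%g = star (T g);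
  pga_mul : forall g h, T g ** T h ** T h^-1%g = T (g * h)%g ** T h^-1%g;
  pga_proj : forall v, is_projection (P (Some v));
  pga_comm1 : forall g h v,
    commuting (T g ** star (T g)) (T h ** P (Some v) ** star (T h));
  pga_comm : forall g h u v,
    commuting (T g ** P (Some u) ** star (T g)) (T h ** P (Some v) ** star (T h))
}.

Record RE_relations (D : cstarAlgType R)
    (T : free_group E1 -> D) (P : option E0 -> D) : Prop := RERelations {
  RE_orth : forall u v, u <> v -> P (Some u) ** P (Some v) = 0;
  RE_source : forall a,
    T (free_gen a)^-1%g ** star (T (free_gen a)^-1%g) - P (Some (s a)) = 0;
  RE_range_orth : forall a b, a <> b ->
    T (free_gen a) ** star (T (free_gen a)) **
      T (free_gen b) ** star (T (free_gen b)) = 0;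
  RE_sum : forall v, r @^-1` [set v] !=set0 -> finite_set (r @^-1` [set v]) ->
    P (Some v) - \sum_(a \in r @^-1` [set v])
      T (free_gen a) ** star (T (free_gen a)) = 0;
  RE_length : forall g h,
    free_length (g * h)%g = (free_length g + free_length h)%N ->
    T (g * h)%g ** star (T (g * h)%g) ** T g ** star (T g)
      - T (g * h)%g ** star (T (g * h)%g) = 0;
  RE_range : forall a,
    T (free_gen a) ** star (T (free_gen a)) ** P (Some (r a))
      - T (free_gen a) ** star (T (free_gen a)) = 0
}.

Definition is_partial_group_cstar (A : cstarAlgType R)
    (f : free_group E1 + option E0 -> A) : Prop :=
  is_universal
    (fun D (h : free_group E1 + option E0 -> D) =>
       partial_group_relations (h \o inl) (h \o inr) /\
       RE_relations (h \o inl) (h \o inr)) f.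

End relations.

(* Main.v *)
Require Import Defs.
From mathcomp Require Import all_boot all_order all_algebra.
From mathcomp Require Import all_classical all_reals all_analysis.
From mathcomp Require Import complex.

(** The two algebras are shown to have each other's generators, and universality
does the rest.

Let S_w be the product of the operators S_a and S_a^* spelled by a word w in
the letters a, a^-1, with S_w = 1 for the empty word. In the unitization of the
graph algebra, [g] |-> S_g (g read as its reduced word), P_v |-> Q_v, P_0 |-> 1
satisfies all the relations defining the partial group algebra
([partial_group_relations_op], [RE_relations_op]). Everything here rests on the
commutation of the projections S_w S_w^* and S_w Q_v S_w^*. Since S_a^* S_b = 0
for a <> b, each of these is 0, 1, or of the form S_mu Q_v S_mu^* or
S_mu S_mu^* with mu a path; such elements form a commutative set, because two
of them are either orthogonal or nested. With this commutation, S_w is a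
partial isometry and cancelling a pair l l^-1 inside a product is harmless when
an initial projection on the left absorbs it ([word_op_reduce]); this is the
relation [g][h][h^-1] = [gh][h^-1] in adjoint form.

Conversely, S_a |-> [a], Q_v |-> P_v satisfies the graph relations in the
partial group algebra ([graph_relations_partial_rep]), hence gives a
homomorphism on the graph algebra, which extends to the unitization by sending
the new unit to 1.

The two homomorphisms are inverse to each other because they are so on
generators. On the side of the graph algebra this is immediate. On the other
side it says that [g] is determined by the [a]: the relation on lengths makes
g |-> [g] semi-saturated, [gh] = [g][h] whenever no cancellation occurs in gh
([partial_rep_semisaturated]), so [g] is the product of the operators of the
letters of g ([partial_rep_word_op]). *)

Set Implicit Arguments.
Unset Strict Implicit.
Unset Printing Implicit Defensive.

Import GRing.Theory Num.Theory.
Local Open Scope classical_set_scope.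
Local Open Scope ring_scope.

(** * Homomorphisms of C*-algebras *)

Section star_homs.
Context {R : realType}.
Implicit Types A B D : cstarAlgType R.

Lemma star_homD A B (phi : A -> B) : is_star_hom phi ->
  {morph phi : x y / x + y}.
Proof. by move=> [lin _ _] x y; have := lin 1 x y; rewrite !scale1r. Qed.

Lemma star_hom0 A B (phi : A -> B) : is_star_hom phi -> phi 0 = 0.
Proof.
by move=> hphi; apply: (addIr (phi 0)); rewrite -star_homD// !add0r.
Qed.

Lemma star_homZ A B (phi : A -> B) : is_star_hom phi ->
  forall (k : R[i]) x, phi (k *: x) = k *: phi x.
Proof.
move=> hphi k x; have [lin _ _] := hphi.
by have := lin k x 0; rewrite (star_hom0 hphi) !addr0.
Qed.

Lemma star0 D : star (0 : D) = 0.
Proof. by apply: (addIr (star 0)); rewrite -starD !add0r. Qed.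

Lemma star_hom_id A : is_star_hom (fun x : A => x).
Proof. by []. Qed.

Lemma star_hom_comp A B D (phi : A -> B) (psi : B -> D) :
  is_star_hom phi -> is_star_hom psi -> is_star_hom (fun x => psi (phi x)).
Proof.
move=> [lin1 mul1 star1] [lin2 mul2 star2]; split.
- by move=> k x y; rewrite lin1 lin2.
- by move=> x y; rewrite mul1 mul2.
- by move=> x; rewrite star1 star2.
Qed.

Lemma star_hom_graph_relations (E0 E1 : choiceType) (r s : E1 -> E0) B D
    (phi : B -> D) (Q : E0 -> B) (S : E1 -> B) :
  is_star_hom phi -> graph_relations r s Q S ->
  graph_relations r s (fun v => phi (Q v)) (fun a => phi (S a)).
Proof.
move=> hphi [proj orth pisom rorth src rle sum].
have [_ mul st] := hphi; split.
- by move=> v; have [p1 p2] := proj v; split; rewrite -?st -?mul ?p1 ?p2.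
- by move=> u v uv; rewrite -mul orth// star_hom0.
- by move=> a; rewrite /is_partial_isometry -st -!mul pisom.
- by move=> a b ab; rewrite -st -mul rorth// star_hom0.
- by move=> a; rewrite -st -mul src.
- by move=> a; rewrite /proj_le -st -!mul rle.
- move=> v v0 vfin; rewrite sum// !fsbig_finite//.
  rewrite (big_morph _ (star_homD hphi) (star_hom0 hphi)).
  by apply: eq_bigr => b _; rewrite mul st.
Qed.

(** Both homomorphisms solve the universal problem posed by the family of their
common values on the generators. *)
Lemma universal_hom_unique (G : Type)
    (rel : forall D : cstarAlgType R, (G -> D) -> Prop) B (f : G -> B) D
    (phi psi : B -> D) :
  is_universal rel f -> rel D (fun x => phi (f x)) ->
  is_star_hom phi -> is_star_hom psi -> (forall x, psi (f x) = phi (f x)) ->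
  forall b, phi b = psi b.
Proof.
move=> [_ univ] rphi hphi hpsi psiE b.
have [chi [_ chi_uniq]] := univ D _ rphi.
by rewrite -(chi_uniq phi)// -(chi_uniq psi).
Qed.

Lemma star_unit D (u : D) : is_unit u -> star u = u.
Proof.
move=> uu; have us := (uu (star u)).1.
by have := congr1 star us; rewrite starM starK us.
Qed.

Lemma star_partial_isometry D (x : D) :
  is_partial_isometry x -> is_partial_isometry (star x).
Proof.
by move=> xE; rewrite /is_partial_isometry -!starM cmulA xE.
Qed.

End star_homs.

(** * Maps into and out of the unitization *)

Section unitization_maps.
Context {R : realType} {B : cstarAlgType R}.

Definition unit_inj (b : B) : unitization B := (b, 0).

Lemma unit_inj_star_hom : is_star_hom unit_inj.
Proof.
split.
- by move=> k x y; congr pair; rewrite /= scaler0 addr0.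
- by move=> x y; congr pair; rewrite /= ?mulr0// !scale0r !addr0.
- by move=> x; congr pair; rewrite /= conjC0.
Qed.

Definition unit_ext {D : cstarAlgType R} (one : D) (psi : B -> D)
    (x : unitization B) : D := psi x.1 + x.2 *: one.

Lemma unit_ext_star_hom (D : cstarAlgType R) (one : D) (psi : B -> D) :
  is_unit one -> is_star_hom psi -> is_star_hom (unit_ext one psi).
Proof.
move=> u1 hpsi; have [lin mul st] := hpsi; split.
- move=> k x y; rewrite /unit_ext /= lin scalerDl -scalerA scalerDr.
  by rewrite addrACA.
- move=> x y; rewrite /unit_ext /=.
  rewrite !(star_homD hpsi) mul !(star_homZ hpsi).
  rewrite !(cmulDl, cmulDr, cmulZl, cmulZr).
  rewrite (u1 (psi y.1)).1 (u1 (psi x.1)).2 (u1 one).1 scalerA.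
  by rewrite -!addrA; congr (_ + _); rewrite addrCA mulrC.
- by move=> x; rewrite /unit_ext /= starD starZ (star_unit u1) st.
Qed.

End unitization_maps.

(** * Products without cancellation in the free group *)

Section free_group_length.
Context {X : choiceType}.
Implicit Types w u : seq (letter X).

Lemma size_push (l : letter X) w : (size (push l w) <= (size w).+1)%N.
Proof. by case: w => //= m w; case: ifP => //= _; rewrite ltnW. Qed.

Lemma size_reduce_onto w u : (size (reduce_onto w u) <= size u + size w)%N.
Proof.
elim: u => //= l u IH.
by rewrite (leq_trans (size_push _ _))// addSn ltnS.
Qed.

Lemma reduce_onto_cat w u :
  size (reduce_onto w u) = (size u + size w)%N -> reduce_onto w u = u ++ w.
Proof.
elim: u => //= l u IH; rewrite /reduce_onto /= -/(reduce_onto w u) => szE.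
have szE' : size (reduce_onto w u) = (size u + size w)%N.
  apply/eqP; rewrite eqn_leq size_reduce_onto -ltnS -addSn -szE.
  exact: size_push.
rewrite -IH//; move: szE; rewrite addSn -szE'.
case: (reduce_onto w u) => //= m v; case: ifP => //= _ /eqP.
by rewrite -addn2 -[X in X == _]addn0 eqn_add2l.
Qed.

End free_group_length.

(** * The partial representation defined by a graph family *)

Section path_operators.
Context {R : realType} {E0 E1 : choiceType} {r s : E1 -> E0}.
Context {D : cstarAlgType R} (one : D) (Q : E0 -> D) (S : E1 -> D).
Hypotheses (unit1 : is_unit one) (rels : graph_relations r s Q S).

Let mul1x x : one ** x = x. Proof. by have [] := unit1 x. Qed.
Let mulx1 x : x ** one = x. Proof. by have [] := unit1 x. Qed.

(** S_a S_a^* <= Q_(r a) places the range of S_a under Q_(r a), and the other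
vertex projections are orthogonal to the latter. *)
Lemma vertex_mul_edge v a : Q v ** S a = if v == r a then S a else 0.
Proof.
have [_ orth pisom _ _ rle _] := rels.
have rS : Q (r a) ** S a = S a.
  have := congr1 star (rle a).
  rewrite starM !starM starK (graph_proj rels _).1 => QSS.
  by rewrite -{1}[S a]pisom !cmulA -[Q _ ** _ ** _]cmulA QSS pisom.
have [->//|/eqP vr] := eqVneq v (r a).
by rewrite -rS cmulA orth// cmul0x.
Qed.

Lemma edge_star_mul_vertex v a :
  star (S a) ** Q v = if v == r a then star (S a) else 0.
Proof.
have := congr1 star (vertex_mul_edge v a).
rewrite starM (graph_proj rels _).1 => ->.
by case: ifP => // _; exact: star0.
Qed.

(** The elements S_mu x S_mu^* for a path mu and x equal to 0, 1 or Q_v. The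
element 0 is included because words containing a^-1 b, with a <> b, produce it.
The inductive form turns prefix comparison of paths into a comparison of their
first edges. *)
Inductive diagonal : D -> Prop :=
| diagonal0 : diagonal 0
| diagonal1 : diagonal one
| diagonalQ v : diagonal (Q v)
| diagonalS a d : diagonal d -> diagonal (S a ** d ** star (S a)).

Lemma vertex_commute_diagonal v d : diagonal d -> commuting (Q v) d.
Proof.
rewrite /commuting; case=> [||u|a {}d _].
- by rewrite cmul0 cmul0x.
- by rewrite mul1x mulx1.
- have [->//|/eqP vu] := eqVneq v u.
  by rewrite !(graph_orth rels)//; exact/nesym.
- rewrite !cmulA vertex_mul_edge -!cmulA edge_star_mul_vertex.
  by case: ifP; rewrite ?cmul0 ?cmul0x.
Qed.

(** Peeling the first edge of both paths: distinct edges have orthogonal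
ranges, so both products vanish, while a common edge reduces the claim to
shorter paths, up to a vertex projection that commutes with everything. *)
Lemma diagonal_commute d d' : diagonal d -> diagonal d' -> commuting d d'.
Proof.
move=> dd; elim: dd d' => {d} [||v|a d dd IH] d' dd'; rewrite /commuting.
- by rewrite cmul0 cmul0x.
- by rewrite mul1x mulx1.
- exact: vertex_commute_diagonal.
case: dd' => [||v|b e de].
- by rewrite cmul0 cmul0x.
- by rewrite mul1x mulx1.
- by symmetry; apply: vertex_commute_diagonal; exact: diagonalS.
have [<-|/eqP ab] := eqVneq a b; last first.
  have [_ _ _ rorth _ _ _] := rels.
  rewrite !cmulA -(cmulA _ (star (S a))) rorth// cmul0 !cmul0x.
  by rewrite -(cmulA _ (star (S b))) rorth ?cmul0 ?cmul0x//; exact/nesym.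
have conjM x y : S a ** x ** star (S a) ** (S a ** y ** star (S a)) =
    S a ** (x ** (Q (s a) ** y)) ** star (S a).
  by rewrite -(graph_source rels) !cmulA.
rewrite !conjM; congr (_ ** _ ** _).
rewrite (vertex_commute_diagonal (s a) de) [LHS]cmulA IH// -cmulA.
by rewrite -(vertex_commute_diagonal (s a) dd).
Qed.

Lemma vertex_mul_diagonal v d : diagonal d -> diagonal (Q v ** d).
Proof.
case=> [||u|a {}d dd].
- by rewrite cmul0; exact: diagonal0.
- by rewrite mulx1; exact: diagonalQ.
- have [->|/eqP vu] := eqVneq v u.
    by rewrite (graph_proj rels u).2; exact: diagonalQ.
  by rewrite (graph_orth rels)//; exact: diagonal0.
- rewrite !cmulA vertex_mul_edge; case: ifP => _; first exact: diagonalS.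
  by rewrite !cmul0x; exact: diagonal0.
Qed.

(** Conjugation by S_a^* removes the first edge of the path, leaving vertex
projections that [vertex_mul_diagonal] absorbs, or kills the element when that
edge is not a. Together with the constructor [diagonalS],
this makes [diagonal] stable under conjugation by any S_w. *)
Lemma diagonal_conj_star a d :
  diagonal d -> diagonal (star (S a) ** d ** S a).
Proof.
have [_ _ _ rorth src _ _] := rels.
case=> [||u|b {}d dd].
- by rewrite cmul0 cmul0x; exact: diagonal0.
- by rewrite mulx1 src; exact: diagonalQ.
- rewrite -cmulA vertex_mul_edge; case: ifP => _.
    by rewrite src; exact: diagonalQ.
  by rewrite cmul0; exact: diagonal0.
- have [<-|/eqP ab] := eqVneq a b.
    rewrite !cmulA src -cmulA src -cmulA; apply: vertex_mul_diagonal.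
    by rewrite -vertex_commute_diagonal//; exact: vertex_mul_diagonal.
  by rewrite !cmulA rorth// !cmul0x; exact: diagonal0.
Qed.

Definition letter_op (l : letter E1) : D := if l.2 then S l.1 else star (S l.1).

Definition word_op (w : seq (letter E1)) : D :=
  foldr (fun l x => letter_op l ** x) one w.

Lemma letter_op_inv l : letter_op (letter_inv l) = star (letter_op l).
Proof. by case: l => a [] //=; rewrite /letter_op /= starK. Qed.

Lemma letter_op_pisom l :
  letter_op l ** star (letter_op l) ** letter_op l = letter_op l.
Proof.
have pisom := graph_pisom rels; case: l => a [] /=; rewrite /letter_op /=.
  exact: pisom.
exact: star_partial_isometry.
Qed.

Lemma diagonal_letter_conj l d :
  diagonal d -> diagonal (letter_op l ** d ** star (letter_op l)).
Proof.
case: l => a [] dd; rewrite /letter_op /=; first exact: diagonalS.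
by rewrite starK; exact: diagonal_conj_star.
Qed.

Lemma word_op_cat u v : word_op (u ++ v) = word_op u ** word_op v.
Proof. by elim: u => /= [|l u ->]; rewrite ?mul1x ?cmulA. Qed.

Lemma word_op_inv w : word_op (word_inv w) = star (word_op w).
Proof.
elim: w => [|l w IH]; first by rewrite star_unit.
rewrite /word_inv map_cons rev_cons -cats1 word_op_cat -/(word_inv w) IH /=.
by rewrite mulx1 letter_op_inv starM.
Qed.

Lemma diagonal_word_conj w d :
  diagonal d -> diagonal (word_op w ** d ** star (word_op w)).
Proof.
move=> dd; elim: w => [|l w IH] /=.
  by rewrite (star_unit unit1) mul1x mulx1.
have := diagonal_letter_conj l IH.
by rewrite starM !cmulA.
Qed.

Lemma diagonal_word w : diagonal (word_op w ** star (word_op w)).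
Proof. by have := diagonal_word_conj w diagonal1; rewrite mulx1. Qed.

Lemma diagonal_letter_source l : diagonal (star (letter_op l) ** letter_op l).
Proof.
have := diagonal_word [:: letter_inv l].
by rewrite /= mulx1 letter_op_inv starK.
Qed.

(** A product of partial isometries need not be one; here it is, because the
range projection of the tail commutes with the source projection of the first
letter. *)
Lemma word_op_pisom w : word_op w ** star (word_op w) ** word_op w = word_op w.
Proof.
elim: w => [|l w IH] /=; first by rewrite (star_unit unit1) !mul1x.
set V := letter_op l; set W := word_op w in IH *.
have VW : commuting (W ** star W) (star V ** V).
  exact: diagonal_commute (diagonal_word w) (diagonal_letter_source l).
rewrite starM (_ : _ ** (V ** W) = V ** ((W ** star W) ** (star V ** V)) ** W).
  by rewrite VW -!cmulA (cmulA W) IH !cmulA letter_op_pisom.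
by rewrite !cmulA.
Qed.

(** The source projection of the letter l absorbs the cancellation that may
occur when l is put in front of a word, as S_l^* S_l S_l^* = S_l^*. *)
Lemma letter_op_push l w :
  star (letter_op l) ** letter_op l ** word_op w =
  star (letter_op l) ** word_op (push l w).
Proof.
case: w => [|m w] /=; first by rewrite !mulx1.
case: eqVneq => [->|_] /=; last by rewrite !cmulA.
rewrite letter_op_inv cmulA -letter_op_inv.
by have := letter_op_pisom (letter_inv l); rewrite letter_op_inv starK => ->.
Qed.

(** The adjoint form of [g][h][h^-1] = [gh][h^-1]. The product in the free group
pushes the letters of the left factor one at a time, and in this form each
letter comes with its own source projection, so that [letter_op_push] takes
care of the cancellation it may cause. *)
Lemma word_op_reduce u v :
  star (word_op u) ** word_op u ** word_op v =
  star (word_op u) ** word_op (reduce_onto v u).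
Proof.
elim: u => [|l u IH] /=; first by rewrite (star_unit unit1) !mul1x.
set V := letter_op l; set U := word_op u in IH *.
set K := word_op (reduce_onto v u) in IH.
have VU : commuting (U ** star U) (star V ** V).
  exact: diagonal_commute (diagonal_word u) (diagonal_letter_source l).
(* Inserts S_u S_u^* on the right of the source projection of l, to expose the
   left-hand side of the induction hypothesis. *)
have step x : star U ** (star V ** V) ** x =
    star U ** (star V ** V) ** (U ** star U ** x).
  rewrite -[star U in LHS](star_partial_isometry (word_op_pisom u)) starK -/U.
  have -> : star U ** U ** star U ** (star V ** V) =
      star U ** ((U ** star U) ** (star V ** V)) by rewrite !cmulA.
  by rewrite VU !cmulA.
rewrite starM; transitivity (star U ** (star V ** V) ** K).
  have -> : star U ** star V ** (V ** U) ** word_op v =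
      star U ** (star V ** V) ** (U ** word_op v) by rewrite !cmulA.
  rewrite step [RHS]step; congr (_ ** _).
  by rewrite -!cmulA (cmulA (star U) U) IH.
by rewrite -[LHS]cmulA letter_op_push cmulA.
Qed.

Definition group_op (g : free_group E1) : D := word_op g.

Definition vertex_op (o : option E0) : D := if o is Some v then Q v else one.

Lemma group_op_inv g : group_op g^-1%g = star (group_op g).
Proof. exact: word_op_inv. Qed.

Lemma group_op_gen a : group_op (free_gen a) = S a.
Proof. exact: mulx1. Qed.

Lemma partial_group_relations_op : partial_group_relations group_op vertex_op.
Proof.
split => //=.
- exact: group_op_inv.
- move=> g h; have := congr1 star (word_op_reduce (word_inv h) (word_inv g)).
  rewrite !starM !word_op_inv !starK -cmulA.
  have -> : reduce_onto (word_inv g) (word_inv h) = word_inv (word (g * h)%g).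
    by have /(congr1 (@word _)) := @invgM (free_group E1) g h.
  by rewrite word_op_inv starK group_op_inv cmulA.
- exact: (graph_proj rels).
- move=> g h v; apply: diagonal_commute; first exact: diagonal_word.
  exact/diagonal_word_conj/diagonalQ.
- move=> g h u v; apply: diagonal_commute.
    exact/diagonal_word_conj/diagonalQ.
  exact/diagonal_word_conj/diagonalQ.
Qed.

(** For the length relation, gh is the concatenation of g and h, so that
S_gh = S_g S_h, whose range lies in that of S_g. *)
Lemma RE_relations_op : RE_relations r s group_op vertex_op.
Proof.
have [_ orth _ rorth src rle sum] := rels; split => /=.
- exact: orth.
- by move=> a; rewrite group_op_inv starK group_op_gen src subrr.
- move=> a b ab; rewrite !group_op_gen -(cmulA (S a)) rorth// cmul0.
  exact: cmul0x.
- move=> v v0 vfin; rewrite sum// !fsbig_finite//.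
  by under [X in _ - X]eq_bigr do rewrite group_op_gen; rewrite subrr.
- move=> g h gh; set p := group_op (g * h)%g ** _.
  have pE : group_op (g * h)%g = group_op g ** group_op h.
    by rewrite -[RHS]word_op_cat -reduce_onto_cat.
  rewrite -(cmulA p).
  have -> : commuting p (group_op g ** star (group_op g)).
    by apply: diagonal_commute; exact: diagonal_word.
  rewrite /p {1}pE !cmulA word_op_pisom -pE; exact: subrr.
- by move=> a; rewrite !group_op_gen rle subrr.
Qed.

End path_operators.

Lemma star_hom_word_op (R : realType) (E1 : choiceType) (A B : cstarAlgType R)
    (phi : A -> B) (oneA : A) (oneB : B) (SA : E1 -> A) (SB : E1 -> B) w :
  is_star_hom phi -> phi oneA = oneB -> (forall a, phi (SA a) = SB a) ->
  phi (word_op oneA SA w) = word_op oneB SB w.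
Proof.
move=> [_ mul st] phi1 phiS; elim: w => //= -[a b] w IH.
by rewrite mul IH /letter_op /=; case: b; rewrite ?st phiS.
Qed.

(** * The graph family defined by a partial representation *)

Section partial_representations.
Context {R : realType} {E0 E1 : choiceType} {r s : E1 -> E0}.
Context {A : cstarAlgType R} (T : free_group E1 -> A) (P : option E0 -> A).
Hypotheses (pgr : partial_group_relations T P) (rer : RE_relations r s T P).

Let mul1x x : P None ** x = x. Proof. by have [] := pga_unit pgr x. Qed.

Lemma partial_rep_pisom g : T g ** star (T g) ** T g = T g.
Proof.
have := pga_mul pgr g g^-1%g.
by rewrite invgK mulgV (pga_one pgr) mul1x (pga_inv pgr).
Qed.

(** The adjoint of [h^-1][g^-1][g] = [h^-1 g^-1][g], multiplied on the left
by [g]. *)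
Lemma partial_rep_mul g h :
  T g ** T h = T g ** star (T g) ** T (g * h)%g.
Proof.
rewrite -[in LHS](partial_rep_pisom g) -!cmulA; congr (_ ** _).
have := congr1 star (pga_mul pgr h^-1%g g^-1%g).
by rewrite !starM invgK -invgM !(pga_inv pgr) !starK cmulA.
Qed.

(** When gh involves no cancellation, the length relation says that the range
of [gh] lies in that of [g], so the projection [g][g]^* of the previous lemma
acts trivially on [gh]. *)
Lemma partial_rep_semisaturated g h :
  free_length (g * h)%g = (free_length g + free_length h)%N ->
  T (g * h)%g = T g ** T h.
Proof.
move=> gh; rewrite partial_rep_mul.
have /subr0_eq/(congr1 star) := RE_length rer gh.
rewrite !starM !starK -!cmulA => ghE.
have := congr1 (fun x => x ** T (g * h)%g) ghE.
by rewrite -!cmulA [_ ** (_ ** T (g * h)%g)]cmulA partial_rep_pisom => ->.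
Qed.

Lemma partial_rep_word_op g : T g = word_op (P None) (T \o @free_gen E1) g.
Proof.
case: g => w rw; elim: w rw => [|l w IH] rlw.
  by rewrite -(pga_one pgr); congr T; exact: val_inj.
have rw : reduced w by exact: path_sorted rlw.
pose gl := @FreeGroup _ [:: l] isT.
have lwE : FreeGroup rlw = (gl * FreeGroup rw)%g.
  apply: val_inj; rewrite /=.
  by case: w rlw {IH rw} => [//|m w] /= /andP[/negPf ->].
rewrite /= -(IH rw) lwE partial_rep_semisaturated -?lwE//; congr (_ ** _).
case: l {rlw lwE} @gl => a []; rewrite /letter_op //=.
by rewrite -(pga_inv pgr); congr T; exact: val_inj.
Qed.

Lemma graph_relations_partial_rep :
  graph_relations r s (P \o Some) (T \o @free_gen E1).
Proof.
have [orth src rorth sum _ rge] := rer; split => /=.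
- exact: (pga_proj pgr).
- exact: orth.
- by move=> a; exact: partial_rep_pisom.
- move=> a b ab; set x := T _; set y := T _.
  rewrite -[star x](star_partial_isometry (partial_rep_pisom _)) starK.
  rewrite -[y]partial_rep_pisom.
  transitivity (star x ** (x ** star x ** y ** star y) ** y).
    by rewrite !cmulA.
  by rewrite rorth// cmul0 cmul0x.
- by move=> a; have /subr0_eq := src a; rewrite (pga_inv pgr) starK.
- by move=> a; have /subr0_eq := rge a.
- by move=> v v0 vfin; have /subr0_eq := sum v v0 vfin.
Qed.

End partial_representations.

(** * The isomorphism *)

Theorem theorem5p3 (R : realType) (E0 E1 : choiceType) (r s : E1 -> E0)
  (A : cstarAlgType R) (fA : free_group E1 + option E0 -> A)
  (B : cstarAlgType R) (fB : E0 + E1 -> B) :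
  is_partial_group_cstar r s fA ->
  is_graph_cstar r s fB ->
  star_isomorphic A (unitization B).
Proof.
move=> univA univB.
have [[pgr rer] extA] := univA; have [relB extB] := univB.
have unitU := @unitization_unit R B.
set Q : E0 -> unitization B := fun v => unit_inj (fB (inl v)).
set S : E1 -> unitization B := fun a => unit_inj (fB (inr a)).
have relU : graph_relations r s Q S.
  exact: star_hom_graph_relations (unit_inj_star_hom (B:=B)) relB.
set one : unitization B := (0, 1) in unitU.
have [phi [[hphi phiE] _]] := extA _
  (fun x => match x with
            | inl g => group_op one S g
            | inr o => vertex_op one Q o
            end)
  (conj (partial_group_relations_op unitU relU) (RE_relations_op unitU relU)).
have relA := graph_relations_partial_rep pgr rer.
have [psi0 [[hpsi0 psi0E] _]] := extB _
  (fun x => match x with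
            | inl v => fA (inr (Some v))
            | inr a => fA (inl (free_gen a))
            end)
  relA.
have unitA := pga_unit pgr; rewrite /= in unitA.
set psi := unit_ext (fA (inr None)) psi0.
have hpsi : is_star_hom psi by exact: unit_ext_star_hom.
have psi_inj b : psi (unit_inj b) = psi0 b.
  by rewrite /psi /unit_ext /= scale0r addr0.
have psi_one : psi one = fA (inr None).
  by rewrite /psi /unit_ext /= (star_hom0 hpsi0) scale1r add0r.
exists phi => //; exists psi => [a|x].
  symmetry.
  apply: (universal_hom_unique univA (phi := id) (psi := psi \o phi)).
  - exact: univA.1.
  - exact: star_hom_id.
  - exact: star_hom_comp.
  - case=> [g|[v|]]; rewrite /= phiE /=.
    + rewrite [RHS](partial_rep_word_op pgr rer).
      apply: star_hom_word_op => // a'.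
      by rewrite psi_inj psi0E.
    + by rewrite psi_inj psi0E.
    + exact: psi_one.
have phi_psi0 b : phi (psi0 b) = unit_inj b.
  symmetry.
  apply: (universal_hom_unique univB (psi := phi \o psi0)).
  - exact: relU.
  - exact: unit_inj_star_hom.
  - exact: star_hom_comp.
  - by case=> [v|a]; rewrite /= psi0E phiE //=; exact: group_op_gen.
rewrite /psi /unit_ext (star_homD hphi) (star_homZ hphi) phi_psi0 phiE.
case: x => b k; congr pair => /=; first by rewrite scaler0 addr0.
by rewrite add0r; exact: mulr1.
Qed.
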